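(* Let $q=2^h$, $h>5$, let $\alpha_{1},\alpha_{2},\alpha_{3},\alpha_{4}\in\mathbb{F}^{*}_{q}$ be $\mathbb{F}_{2}$-independent and define $S=\{x\in\mathbb{F}_{q}\mid \mathrm{Tr}(\alpha_{i}x)=0\text{ for }i=1,2,3,4\}$. Assume that $\frac{\alpha^{2}_{i}}{\alpha_{4}}\in\langle\alpha_{1},\alpha_{2},\alpha_{3},\alpha_{4}\rangle$ for $i=1,2,3$, and let $\alpha\in\langle\alpha_{1},\alpha_{2},\alpha_{3},\alpha_{4}\rangle$ be such that $\{\alpha_{1}(\alpha_{1}+\alpha_{4}),\alpha_{2}(\alpha_{2}+\alpha_{4}),\alpha_{3}(\alpha_{3}+\alpha_{4}),\alpha_{4}\alpha\}$ is an $\mathbb{F}_{2}$-independent set. Let $\beta_{1},\beta_{2},\beta_{3}\in\mathbb{F}^{*}_{q}$ be such that $\mathrm{Tr}(\alpha_{i}\beta_{j})=\delta_{i,j}$ for $i=1,\dots,4$ and $j=1,2,3$, and let $f_{1},f_{2},f_{3}:\mathbb{F}_2^3\to\mathbb{F}_2$ be given by $f_{1}(x,y,z)= x+y+z+yz$, $f_{2}(x,y,z)= y+z+xz$ and $f_{3}(x,y,z)= z+xy$. For any $\overline{\lambda}=(\lambda_{1},\dots,\lambda_{4})\in\mathbb{F}^{4}_{2}$ define $$\mathcal{S}_{\overline{\lambda}}=\left\{\left(1,\sum^{4}_{i=1}\lambda_{i}\alpha_{i},\sum^{3}_{i=1}f_{i}(\lambda_{1},\lambda_{2},\lambda_{3})\beta_{i}+s\right)\Big|\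 s\in S\right\}.$$ Also define $\mathcal{S}_{0}=\{(0,1,x)\mid x\in\mathbb{F}_q,\ \mathrm{Tr}(\alpha_{i}(\alpha_{i}+\alpha_{4})x)=0 \text{ for } i=1,2,3,\text{ and } \mathrm{Tr}(\alpha_{4}\alpha x)=1\}$ (a set distinct from the one indexed by the zero vector of $\mathbb{F}_2^4$). Then the point set $\mathcal{A}=\mathcal{S}_{0}\cup\bigcup_{\overline{\lambda}\in\mathbb{F}^{4}_{2}}\mathcal{S}_{\overline{\lambda}}$ is an elation KM-arc of type $q/16$ in $\mathrm{PG}(2,q)$ with elation line $X=0$ and $q/16$-nucleus $(0,0,1)$.
   Context: $\mathrm{Tr}$ is the absolute trace $\mathbb{F}_q\to\mathbb{F}_2$; $\delta_{i,j}$ is the Kronecker delta; $\langle\cdot\rangle$ denotes the additive subgroup ($\mathbb{F}_2$-span) generated in $\mathbb{F}_q$. Points of $\mathrm{PG}(2,q)$ have homogeneous coordinates $(X,Y,Z)$. A KM-arc of type $t$ in $\mathrm{PG}(2,q)$ is a set of $q+t$ points such that every line meets it in $0$, $2$ or $t$ points (each value occurring); a line meeting it in $i$ points is an $i$-secant. If $t>2$, all $t$-secants pass through one common point, the $t$-nucleus. An elation with axis a line $\ell$ and centre a point $R\in\ell$ is a collineation fixing all points of $\ell$ and stabilising all lines through $R$. A KM-arc $\mathcal{A}$ of type $t>2$ is an elation KM-arc with elation line $\ell_\infty$ if for every $t$-secant $\ell\neq\ell_\infty$ the group of elations with axis $\ell_\infty$ stabilising $\mathcal{A}$ is transitive on the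 points of $\mathcal{A}\cap\ell$ (any point of $\mathcal{A}\cap\ell$ can be mapped to any other one by an element of the group). *)

(* Defs.v *)
From HB Require Import structures.
From mathcomp Require Import all_boot all_order all_algebra all_fingroup.
Set Implicit Arguments. Unset Strict Implicit. Unset Printing Implicit Defensive.
Import GRing.Theory.
Local Open Scope ring_scope.

Section Plane.
Variable F : finFieldType.

(* Points of PG(2,q) are the 1-dimensional subspaces of F^3, each given by its
   canonical 3 x 3 matrix <<_>>%MS, so that equality of points is equality of
   subspaces. *)
Definition point := {U : 'M[F]_3 | (\rank U == 1)%N && (<<U>>%MS == U)}.

HB.instance Definition _ := SubFinite.on point.

(* Never true for (x, y, z) = (0, 0, 0), which has rank 0. *)
Definition has_coords (P : point) (x y z : F) : bool :=
  val P == <<\row_(j < 3) [:: x; y; z]`_j>>%MS.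

(* The line with equation a X + b Y + c Z = 0 (a line only if (a, b, c) is
   nonzero). *)
Definition line (a b c : F) : {set point} :=
  [set P : point | val P *m \col_(j < 3) [:: a; b; c]`_j == 0].

Definition lines : {set {set point}} :=
  [set line u.1.1 u.1.2 u.2 | u : F * F * F & u != (0, 0, 0)].

Definition secants (A : {set point}) (i : nat) : {set {set point}} :=
  [set l in lines | #|A :&: l| == i].

Definition KM_arc (t : nat) (A : {set point}) : Prop :=
  [/\ #|A| = (#|F| + t)%N,
      {in lines, forall l, #|A :&: l| \in [:: 0; 2; t]%N}
    & {in [:: 0; 2; t]%N, forall i, secants A i != set0}].

Definition nucleus (t : nat) (A : {set point}) (N : point) : Prop :=
  \bigcap_(l in secants A t) l = [set N].

Definition collineation (s : {perm point}) : bool :=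
  [forall l in lines, s @: l \in lines].

Definition elation (axis : {set point}) (R : point) (s : {perm point}) : bool :=
  [&& R \in axis, collineation s, [forall P in axis, s P == P]
    & [forall l in lines, (R \in l) ==> (s @: l == l)]].

(* The centre is not fixed: it may be any point of the axis. *)
Definition elation_stab (axis A : {set point}) : {set {perm point}} :=
  [set s | [exists R, elation axis R s] && (s @: A == A)].

(* Transitivity on A :&: l means that any point of A :&: l can be mapped to any
   other; elation_stab linf A need not stabilise l, so the library notation
   [transitive _, on _ | _] would be too strong. *)
Definition elation_KM_arc (t : nat) (A linf : {set point}) : Prop :=
  [/\ KM_arc t A, (2 < t)%N, linf \in lines
    & {in secants A t, forall l, l != linf ->
        {in A :&: l &, forall P Q, exists2 s, s \in elation_stab linf A & s P = Q}}].

End Plane.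

Section BinaryField.
Variable F : finFieldType.

(* The absolute trace of a field with 2 ^ h elements; its values are the
   elements 0 and 1 of the prime subfield of F. *)
Definition abs_trace (h : nat) (x : F) : F := \sum_(i < h) x ^+ (2 ^ i).

(* In characteristic 2 the multiple v *+ c, with c : 'F_2 read as 0 or 1, is the
   scalar product of v by c. *)
Definition F2_independent (n : nat) (v : 'I_n -> F) : Prop :=
  forall c : 'I_n -> 'F_2, \sum_i v i *+ c i = 0 -> forall i, c i = 0.

(* Generation is in the additive group of F. *)
Definition F2_span (n : nat) (v : 'I_n -> F) : {set F} := <<[set v i | i : 'I_n]>>%g.

End BinaryField.

(* Indices start at 0: alpha_1, ..., alpha_4 are alpha 0, ..., alpha 3, where the
   numerals in 'I_4 and 'I_3 are read modulo 4 and 3. *)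
Section Arc.
Variables (F : finFieldType) (h : nat).
Variables (alpha : 'I_4 -> F) (a : F) (beta : 'I_3 -> F).

Definition S_set : {set F} := [set x | [forall i, abs_trace h (alpha i * x) == 0]].

Definition f_poly (i : 'I_3) (x y z : 'F_2) : 'F_2 :=
  [:: x + y + z + y * z; y + z + x * z; z + x * y]`_i.

(* alpha_i (alpha_i + alpha_4) for i = 1, 2, 3, followed by alpha_4 a. *)
Definition gamma (i : 'I_4) : F :=
  if (i < 3)%N then alpha i * (alpha i + alpha 3) else alpha 3 * a.

Definition S_lambda (l : 'rV['F_2]_4) : {set point F} :=
  [set P | [exists s in S_set,
     has_coords P 1 (\sum_i alpha i *+ l 0 i)
       (\sum_i beta i *+ f_poly i (l 0 0) (l 0 1) (l 0 2) + s)]].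

Definition S_zero : {set point F} :=
  [set P | [exists x : F,
    [&& has_coords P 0 1 x,
        [forall i : 'I_4, (i < 3)%N ==> (abs_trace h (alpha i * (alpha i + alpha 3) * x) == 0)]
      & abs_trace h (alpha 3 * a * x) == 1]]].

Definition arc_points : {set point F} :=
  S_zero :|: \bigcup_(l : 'rV['F_2]_4) S_lambda l.

End Arc.

(* Main.v *)
Require Import Defs.
From HB Require Import structures.
From mathcomp Require Import all_boot all_order all_algebra all_fingroup.
From mathcomp Require Import finfield zify ring.
Set Implicit Arguments. Unset Strict Implicit. Unset Printing Implicit Defensive.
Import GRing.Theory.
Local Open Scope ring_scope.

(* The lines through (0, 0, 1) meet the arc in 0 or q/16 points. A line
   Z = k X + m Y meets S_lambda in at most one point, and does so iff lambda solves
   the system f(lambda) + M lambda = (Tr(alpha_i k))_i over F_2, where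
   f = (f_1, f_2, f_3, 0) and M = (Tr(alpha_i alpha_j m)); its point at infinity is
   (0, 1, m). So the number of solutions must be 1 if (0, 1, m) lies in S_0, and 0
   or 2 otherwise. Two facts link M to m. Since the alpha_i^2 and the gamma_i are
   both bases of the span of the alpha_4 alpha_i, the diagonal of M vanishes iff its
   last row does; and (0, 1, m) lies in S_0 iff the last row is nonzero and equal
   to the diagonal. Under the first condition the count is right for all symmetric
   M, which is a finite computation. The elations required are
   (X, Y, Z) |-> (X, Y, Z + sX) with s in S. *)

(** * Points and lines of PG(2,q) *)

Section PlaneTheory.
Variable F : finFieldType.
Implicit Types (P Q : point F) (x y z a b c : F) (v w : 'rV[F]_3).

Let vec x y z : 'rV[F]_3 := \row_(j < 3) [:: x; y; z]`_j.

Lemma vec_neq0 x y z : (vec x y z != 0) = ((x, y, z) != (0, 0, 0)).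
Proof.
congr negb; apply/eqP/eqP => [/rowP e|[-> -> ->]].
  by have := (e 0, e 1, e 2%:R); rewrite !mxE /= => -[[-> ->] ->].
by apply/rowP=> -[[|[|[|]]] ?] //; rewrite !mxE.
Qed.

Lemma row3_vec v : v = vec (v 0 0) (v 0 1) (v 0 2%:R).
Proof.
by apply/rowP=> -[[|[|[|]]] i] //; rewrite !mxE /=; congr (v _ _); apply/val_inj.
Qed.

Lemma genmx_row_is_point v : v != 0 ->
  (\rank <<v>>%MS == 1)%N && (<< <<v>> >>%MS == <<v>>%MS).
Proof. by move=> v0; rewrite genmx_id eqxx genmxE rank_rV v0. Qed.

Let vec001_neq0 : vec 0 0 1 != 0.
Proof. by rewrite vec_neq0 !xpair_eqE oner_eq0 !andbF. Qed.

(* At the non-point (0, 0, 0) the junk value is (0, 0, 1). *)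
Definition pt x y z : point F :=
  insubd (Sub <<vec 0 0 1>>%MS (genmx_row_is_point vec001_neq0)) <<vec x y z>>%MS.

Lemma val_pt x y z : (x, y, z) != (0, 0, 0) -> val (pt x y z) = <<vec x y z>>%MS.
Proof.
by rewrite -vec_neq0 => /genmx_row_is_point v0; rewrite val_insubd v0.
Qed.

Lemma has_coordsE P x y z :
  (x, y, z) != (0, 0, 0) -> has_coords P x y z = (P == pt x y z).
Proof. by move=> /val_pt e; rewrite -val_eqE e. Qed.

Lemma point_pt P : exists x y z, (x, y, z) != (0, 0, 0) /\ P = pt x y z.
Proof.
have /andP[/eqP rP /eqP gP] := valP P.
pose v := nz_row (val P).
have v0 : v != 0 by rewrite nz_row_eq0 -mxrank_eq0 rP.
exists (v 0 0), (v 0 1), (v 0 2%:R); rewrite -vec_neq0 -row3_vec; split=> //.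
apply/val_inj; rewrite val_pt -?vec_neq0 -row3_vec // -gP.
apply/eq_genmx/eqmx_sym/eqmxP; rewrite -(mxrank_leqif_eq (nz_row_sub _)).
by rewrite rank_rV v0 rP.
Qed.

Lemma genmx_mul_eq0 v (B : 'cV[F]_3) : (<<v>>%MS *m B == 0) = (v *m B == 0).
Proof. by rewrite -!sub_kermx genmxE. Qed.

Lemma mem_line x y z a b c : (x, y, z) != (0, 0, 0) ->
  (pt x y z \in line a b c) = (a * x + b * y + c * z == 0).
Proof.
move=> /val_pt e; rewrite inE e genmx_mul_eq0.
have -> : vec x y z *m \col_j [:: a; b; c]`_j = (a * x + b * y + c * z)%:M.
  apply/rowP=> i; rewrite !mxE !big_ord_recl big_ord0 !mxE /= !ord1 eqxx.
  by rewrite /= addr0 !(mulrC _ a) !(mulrC _ b) !(mulrC _ c) addrA.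
by rewrite -scalemx1 scaler_eq0 oner_eq0 orbF.
Qed.

Lemma coords1_neq0 y z : (1, y, z) != (0, 0, 0) :> F * F * F.
Proof. by rewrite !xpair_eqE oner_eq0. Qed.

Lemma coords01_neq0 z : (0, 1, z) != (0, 0, 0) :> F * F * F.
Proof. by rewrite !xpair_eqE oner_eq0 andbF. Qed.

Lemma coords001_neq0 : (0, 0, 1) != (0, 0, 0) :> F * F * F.
Proof. by rewrite !xpair_eqE oner_eq0 andbF. Qed.

Lemma pt1_inj y z y' z' : pt 1 y z = pt 1 y' z' -> y = y' /\ z = z'.
Proof.
move=> e; split; apply/esym/eqP.
  have := mem_line (- y) 1 0 (coords1_neq0 y z).
  rewrite e mem_line ?coords1_neq0 // !mulr1 !mul1r !mul0r !addr0 addNr eqxx.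
  by rewrite addrC subr_eq0.
have := mem_line (- z) 0 1 (coords1_neq0 y z).
rewrite e mem_line ?coords1_neq0 // !mulr1 !mul1r !mul0r !addr0 addNr eqxx.
by rewrite addrC subr_eq0.
Qed.

Lemma pt01_inj z z' : pt 0 1 z = pt 0 1 z' -> z = z'.
Proof.
move=> e; apply/esym/eqP; have := mem_line 0 (- z) 1 (coords01_neq0 z).
rewrite e mem_line ?coords01_neq0 // !mul0r !add0r !mulr1 !mul1r addNr eqxx.
by rewrite addrC subr_eq0.
Qed.

Lemma pt01_neq_pt1 x y z : pt 0 1 x != pt 1 y z.
Proof.
apply/eqP=> e; have := mem_line 1 0 0 (coords01_neq0 x).
by rewrite e mem_line ?coords1_neq0 // !mulr0 !mul0r mulr1 !addr0 oner_eq0 eqxx.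
Qed.

Lemma mem_lines a b c : (a, b, c) != (0, 0, 0) -> line a b c \in lines F.
Proof. by move=> n0; apply/imsetP; exists (a, b, c); rewrite ?inE. Qed.

Lemma linesP (l : {set point F}) :
  l \in lines F -> exists a b c, (a, b, c) != (0, 0, 0) /\ l = line a b c.
Proof. by case/imsetP=> [[[a b] c]]; rewrite inE => n0 ->; exists a, b, c. Qed.

Lemma eq_line_scale k a b c : k != 0 ->
  line (k * a) (k * b) (k * c) = line a b c.
Proof.
move=> k0; apply/setP=> P; have [x [y [z [n0 ->]]]] := point_pt P.
rewrite !mem_line //.
have -> : k * a * x + k * b * y + k * c * z = k * (a * x + b * y + c * z) by ring.
by rewrite mulf_eq0 (negPf k0).
Qed.

Lemma pt_in_X0_Y0 P : P \in line 1 0 0 -> P \in line 0 1 0 -> P = pt 0 0 1.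
Proof.
have [x [y [z [n0 ->]]]] := point_pt P; rewrite !mem_line //.
rewrite !mul0r !mul1r !addr0 add0r => /eqP ex /eqP ey; subst x y.
have z0 : z != 0 by apply: contraNneq n0 => ->.
apply/val_inj; rewrite !val_pt ?coords001_neq0 //; apply/eq_genmx.
have -> : vec 0 0 z = z *: vec 0 0 1.
  by apply/rowP=> -[[|[|[|]]] i] //; rewrite !mxE /= ?mulr0 ?mulr1.
exact: eqmx_scale.
Qed.

(** * Elations with axis [X = 0] and centre [(0, 0, 1)] *)

Let shear_mx c : 'M[F]_3 := 1%:M + c *: delta_mx 0 2%:R.

(** The matrix unit [delta_mx 0 2%:R] squares to zero. Invertibility follows, with inverse
    [shear_mx (- c)]. *)
Let shear_mxD c c' : shear_mx c *m shear_mx c' = shear_mx (c + c').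
Proof.
rewrite /shear_mx mulmxDl !mulmxDr !mulmx1 mul1mx -scalemxAl -scalemxAr.
by rewrite mul_delta_mx_0 // !scaler0 addr0 scalerDl -addrA [X in 1%:M + X]addrC.
Qed.

Let shear_mx_unit c : shear_mx c \in unitmx.
Proof.
suff /mulmx1_unit[] : shear_mx c *m shear_mx (- c) = 1%:M by [].
by rewrite shear_mxD subrr /shear_mx scale0r addr0.
Qed.

Let shear_vec c x y z : vec x y z *m shear_mx c = vec x y (c * x + z).
Proof.
rewrite /shear_mx mulmxDr mulmx1 -scalemxAr; apply/rowP=> i.
rewrite !mxE !big_ord_recl big_ord0 !mxE /=.
by case: i => -[|[|[|]]] //= i;
  rewrite ?mulr0 ?mulr1 ?mulr0n !addr0 ?mulr0 ?addr0 // addrC.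
Qed.

Let shear_fun_proof c P :
  (\rank <<val P *m shear_mx c>>%MS == 1)%N &&
  (<< <<val P *m shear_mx c>> >>%MS == <<val P *m shear_mx c>>%MS).
Proof.
rewrite genmx_id eqxx genmxE mxrankMfree ?row_free_unit ?shear_mx_unit //.
by have /andP[->] := valP P.
Qed.

Let shear_fun c P : point F := Sub <<val P *m shear_mx c>>%MS (shear_fun_proof c P).

Let shear_fun_pt c x y z : (x, y, z) != (0, 0, 0) ->
  (x, y, c * x + z) != (0, 0, 0) /\ shear_fun c (pt x y z) = pt x y (c * x + z).
Proof.
move=> n0; have n1 : (x, y, c * x + z) != (0, 0, 0).
  apply: contraNneq n0 => -[-> ->]; by rewrite mulr0 add0r => ->.
split=> //; apply/val_inj; rewrite /= !val_pt // -shear_vec.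
by apply/eq_genmx/eqmxMr/genmxE.
Qed.

Let shear_fun_inj c : injective (shear_fun c).
Proof.
apply: (can_inj (g := shear_fun (- c))) => P.
have [x [y [z [n0 ->]]]] := point_pt P.
have [n1 ->] := shear_fun_pt c n0; have [_ ->] := shear_fun_pt (- c) n1.
by rewrite mulNr addKr.
Qed.

(* The collineation (X, Y, Z) |-> (X, Y, cX + Z). *)
Definition shear c : {perm point F} := perm (@shear_fun_inj c).

Lemma shear_pt c x y z : (x, y, z) != (0, 0, 0) ->
  shear c (pt x y z) = pt x y (c * x + z).
Proof. by move=> n0; rewrite permE; have [_ ->] := shear_fun_pt c n0. Qed.

(** In the equation of the image [Z] is replaced by [Z - cX], which changes only the coefficient of
    [X]. *)
Lemma shear_line c (u v w : F) : shear c @: line u v w = line (u - c * w) v w.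
Proof.
suff sub c' u' : shear c' @: line u' v w \subset line (u' - c' * w) v w.
  apply/eqP; rewrite eqEsubset sub /=; apply/subsetP=> P.
  have [x [y [z [n0 ->]]]] := point_pt P; move=> Pl.
  have [n1 _] := shear_fun_pt (- c) n0.
  apply/imsetP; exists (pt x y (- c * x + z)); last first.
    by rewrite shear_pt // mulNr addNKr.
  move: Pl; rewrite !mem_line // => /eqP <-; apply/eqP; ring.
apply/subsetP=> P /imsetP[Q Ql ->].
have [x [y [z [n0 eQ]]]] := point_pt Q; move: Ql; rewrite {}eQ shear_pt //.
have [n1 _] := shear_fun_pt c' n0.
rewrite !mem_line // => /eqP <-; apply/eqP; ring.
Qed.

(** Points with [X = 0] do not move, and a line through [(0, 0, 1)] has [w = 0], so that [u - c * w]
    is still [u]. *)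
Lemma shear_elation c : elation (line 1 0 0) (pt 0 0 1) (shear c).
Proof.
apply/and4P; split.
- by rewrite mem_line ?coords001_neq0 // mulr0 !mul0r !addr0.
- apply/forall_inP=> l /linesP[u [v [w [n0 ->]]]]; rewrite shear_line.
  apply: mem_lines; apply: contraNneq n0 => -[+ -> ew].
  by rewrite ew mulr0 subr0 => ->.
- apply/forall_inP=> P; have [x [y [z [n0 ->]]]] := point_pt P.
  rewrite mem_line // mul1r !mul0r !addr0 shear_pt // => /eqP->.
  by rewrite mulr0 add0r.
- apply/forall_inP=> l /linesP[u [v [w [n0 ->]]]]; apply/implyP.
  rewrite mem_line ?coords001_neq0 // !mulr0 mulr1 !add0r => /eqP->.
  by rewrite shear_line mulr0 subr0.
Qed.

End PlaneTheory.

(** * The absolute trace *)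

Section TraceTheory.
Variables (F : finFieldType) (h : nat).
Hypotheses (h_gt0 : (0 < h)%N) (cardF : #|F| = (2 ^ h)%N).
Implicit Types (x y z w : F).

Lemma pchar2 : (2 \in [pchar F])%R.
Proof. exact: card_finPcharP cardF _. Qed.

Lemma addrr2 x : x + x = 0.
Proof. exact: addrr_pchar2 pchar2 x. Qed.

Lemma oppr2 x : - x = x.
Proof. exact: oppr_pchar2 pchar2 x. Qed.

Lemma addr2_eq0 x y : (x + y == 0) = (x == y).
Proof. by rewrite addr_eq0 oppr2. Qed.

Lemma sqrrD2 x y : (x + y) ^+ 2 = x ^+ 2 + y ^+ 2.
Proof. by rewrite sqrrD mulr2n addrr2 addr0. Qed.

Lemma sqr_sum2 (I : Type) (r : seq I) (P : pred I) (f : I -> F) :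
  (\sum_(i <- r | P i) f i) ^+ 2 = \sum_(i <- r | P i) f i ^+ 2.
Proof. by apply: (big_morph (fun x => x ^+ 2) sqrrD2); rewrite expr0n. Qed.

(** With Boolean values, additivity of the trace becomes exclusive or, and the linear algebra over
    F_2 can be evaluated. *)
Definition tr x : bool := abs_trace h x != 0.

(** Squaring permutes the summands [x ^+ (2 ^ i)] cyclically, because [x ^+ (2 ^ h) = x]. *)
Lemma abs_trace_sqr x : abs_trace h x ^+ 2 = abs_trace h x.
Proof.
rewrite /abs_trace sqr_sum2; case: h h_gt0 cardF => // n _ e.
rewrite big_ord_recr [RHS]big_ord_recl /= addrC expr1 -exprM -expnSr -e expf_card.
by congr (_ + _); apply: eq_bigr => i _; rewrite -exprM -expnSr.
Qed.

Lemma abs_traceE x : abs_trace h x = (tr x)%:R.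
Proof.
rewrite /tr; have [->//|t0] := eqVneq; apply: (mulfI t0).
by rewrite mulr1 -expr2 abs_trace_sqr.
Qed.

Lemma abs_traceD x y : abs_trace h (x + y) = abs_trace h x + abs_trace h y.
Proof.
rewrite /abs_trace -big_split; apply: eq_bigr => i _ /=.
by rewrite exprDn_pchar // pnatX pnatE // pchar2.
Qed.

Lemma abs_trace0 : abs_trace h (0 : F) = 0.
Proof. by rewrite -[RHS](addrr2 (abs_trace h 0)) -abs_traceD addr0. Qed.

Lemma tr0 : tr 0 = false.
Proof. by rewrite /tr abs_trace0 eqxx. Qed.

Lemma trD x y : tr (x + y) = tr x (+) tr y.
Proof.
by rewrite {1}/tr abs_traceD !abs_traceE; do 2!case: (tr _);
  rewrite /= ?addrr2 ?addr0 ?add0r ?eqxx ?oner_eq0.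
Qed.

Lemma tr_sum (I : finType) (P : pred I) (f : I -> F) :
  tr (\sum_(i | P i) f i) = \big[addb/false]_(i | P i) tr (f i).
Proof. exact: (big_morph tr trD tr0). Qed.

(** The trace is a nonzero polynomial of degree at most 2^(h-1), so it cannot vanish at all 2^h
    elements of [F]. *)
Lemma tr_neq0 : exists x, tr x.
Proof.
apply/existsP; apply: contraT; rewrite negb_exists => /forallP tr_eq0.
pose p : {poly F} := \sum_(i < h) 'X^(2 ^ i).
have size_p : (size p <= (2 ^ h.-1).+1)%N.
  apply/(leq_trans (size_sum _ _ _))/bigmax_leqP => i _.
  rewrite size_polyXn ltnS leq_pexp2l // -ltnS prednK //; exact: ltn_ord.
have p0 : p != 0.
  apply: contraTneq isT => /(congr1 (fun q : {poly F} => q`_1)).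
  rewrite coef0 coef_sum (bigD1 (Ordinal h_gt0)) //= coefXn eqxx.
  rewrite big1 ?addr0 => [/eqP|i]; first by rewrite oner_eq0.
  rewrite -val_eqE /= coefXn => i0; case: eqP => // e.
  by have := ltn_exp2l 0 i (isT : 1 < 2)%N; rewrite lt0n i0 -e ltnn.
have rts : all (root p) (enum F).
  apply/allP=> x _; rewrite /root horner_sum.
  under eq_bigr do rewrite hornerXn.
  exact/negPn/tr_eq0.
have := max_poly_roots p0 rts (enum_uniq F); rewrite -cardE cardF ltnNge.
by rewrite (leq_trans size_p) // ltn_exp2l // prednK.
Qed.

Lemma tr_mul_neq0 w : w != 0 -> exists x, tr (w * x).
Proof.
by move=> w0; have [x tx] := tr_neq0; exists (x / w); rewrite mulrCA divff ?mulr1.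
Qed.

(** Orthogonality of characters: if [w != 0], translating [x] by some [y] with Tr(wy) = 1 negates
    the sum. *)
Lemma sum_sign_tr w :
  (\sum_x (-1) ^+ tr (w * x))%R = (if w == 0 then #|F|%:R else 0)%R :> int.
Proof.
have [->|/tr_mul_neq0[y ty]] := eqVneq.
  by under eq_bigr do rewrite mul0r tr0; rewrite sumr_const.
set s := \sum_x _; suff : s = - s by lia.
rewrite {1}/s (reindex_inj (addrI y)) -sumrN; apply: eq_bigr => x _.
by rewrite mulrDr trD ty signr_addb mulN1r.
Qed.

(** * Spans and independence over F_2 *)

Definition span2 n (v : 'I_n -> F) : {set F} :=
  [set \sum_(i in J) v i | J : {set 'I_n}].

(** A combination with coefficients in F_2 is a sum over a subset of the indices; this lemma and the
    next one translate independence accordingly. *)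
Lemma F2_independent_set n (v : 'I_n -> F) (J : {set 'I_n}) :
  F2_independent v -> \sum_(i in J) v i = 0 -> J = set0.
Proof.
move=> ind e; apply/setP=> i; rewrite inE; apply/negbTE/negP=> iJ.
suff : (i \in J)%:R = 0 :> 'F_2 by rewrite iJ.
apply: (ind (fun i => (i \in J)%:R)); rewrite -[RHS]e [RHS]big_mkcond.
by apply: eq_bigr => j _; case: ifP.
Qed.

Lemma F2_independentP n (v : 'I_n -> F) :
  (forall J : {set 'I_n}, \sum_(i in J) v i = 0 -> J = set0) -> F2_independent v.
Proof.
move=> ind c e i; have := ind [set i | c i != 0]; rewrite big_mkcond /=.
have -> : \sum_i (if i \in [set i | c i != 0] then v i else 0) = 0.
  rewrite -[RHS]e; apply: eq_bigr => j _; rewrite inE.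
  by case: (c j) => -[|[|[]]].
by move=> /(_ erefl)/setP/(_ i); rewrite !inE => /negbFE/eqP.
Qed.

Lemma span2D n (v : 'I_n -> F) x y :
  x \in span2 v -> y \in span2 v -> x + y \in span2 v.
Proof.
move=> /imsetP[J _ ->] /imsetP[K _ ->]; apply/imsetP.
(* Common terms cancel in characteristic 2, which leaves the symmetric difference. *)
exists [set i | (i \in J) (+) (i \in K)] => //.
rewrite [RHS]big_mkcond [X in X + _]big_mkcond [X in _ + X]big_mkcond.
rewrite -big_split; apply: eq_bigr => i _ /=; rewrite inE.
by case: (i \in J); case: (i \in K); rewrite /= ?addr0 ?add0r ?addrr2.
Qed.

Lemma span2_0 n (v : 'I_n -> F) : 0 \in span2 v.
Proof. by apply/imsetP; exists set0; rewrite ?big_set0. Qed.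

Lemma span2_gen n (v : 'I_n -> F) i : v i \in span2 v.
Proof. by apply/imsetP; exists [set i]; rewrite ?big_set1. Qed.

Lemma span2_sum n (v : 'I_n -> F) (I : finType) (P : pred I) (f : I -> F) :
  (forall i, P i -> f i \in span2 v) -> \sum_(i | P i) f i \in span2 v.
Proof.
move=> fv; apply: (big_ind (fun x => x \in span2 v)) => //.
  exact: span2_0.
exact: span2D.
Qed.

Lemma F2_span_sub n (v : 'I_n -> F) : F2_span v \subset span2 v.
Proof.
have grp : group_set (span2 v).
  by apply/group_setP; split=> [|x y]; [exact: span2_0 | exact: span2D].
rewrite -[span2 v]/(gval (Group grp)) gen_subG.
by apply/subsetP=> _ /imsetP[i _ ->]; exact: span2_gen.
Qed.

Lemma span2_mull n (v : 'I_n -> F) c x :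
  x \in span2 v -> c * x \in span2 (fun i => c * v i).
Proof.
by move=> /imsetP[J _ ->]; apply/imsetP; exists J; rewrite // mulr_sumr.
Qed.

Lemma tr_span2 n (v : 'I_n -> F) x y :
  (forall i, ~~ tr (v i * x)) -> y \in span2 v -> ~~ tr (y * x).
Proof.
move=> tv /imsetP[J _ ->]; rewrite mulr_suml tr_sum big1 // => i _.
exact/negbTE.
Qed.

(* Cardinalities: both spans have [2 ^ n] elements. *)
Lemma span2_exchange n (v w : 'I_n -> F) : F2_independent v ->
  (forall i, v i \in span2 w) -> forall i, w i \in span2 v.
Proof.
move=> ind vw i; suff -> : span2 v = span2 w by exact: span2_gen.
apply/eqP; rewrite eqEcard; apply/andP; split.
  by apply/subsetP=> _ /imsetP[J _ ->]; apply: span2_sum.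
rewrite /span2 [leqRHS]card_imset ?leq_imset_card // => J K e.
suff : [set i | (i \in J) (+) (i \in K)] = set0.
  move/setP=> JK; apply/setP=> j; have := JK j; rewrite !inE.
  by case: (j \in J); case: (j \in K).
apply: (F2_independent_set ind); rewrite -[RHS](addrr2 (\sum_(i in J) v i)).
rewrite {2}e [LHS]big_mkcond [X in X + _]big_mkcond [X in _ + X]big_mkcond.
rewrite -big_split; apply: eq_bigr => j _ /=; rewrite inE.
by case: (j \in J); case: (j \in K); rewrite /= ?addr0 ?add0r ?addrr2.
Qed.

(* The indicator of the fibre at x is the product of the (1 + (-1)^(Tr(v_i x) +
   b_i)) / 2, whose expansion is a combination of additive characters; only the
   trivial one has a nonzero sum. *)
Lemma card_tr_fiber n (v : 'I_n -> F) (b : 'I_n -> bool) : F2_independent v ->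
  (#|[set x : F | [forall i, tr (v i * x)%R == b i]]| * 2 ^ n = #|F|)%N.
Proof.
move=> ind; set S := [set x | _]; apply/eqP; rewrite -eqz_nat PoszM; apply/eqP.
have ind_S (x : F) : (\prod_i ((-1) ^+ (tr (v i * x) (+) b i) + 1))%R =
    ((x \in S)%:R * (2 ^ n)%:R)%R :> int.
  have [xS|] := boolP (x \in S).
    rewrite inE in xS; rewrite mul1r (eq_bigr (fun _ => 2)).
      by rewrite prodr_const card_ord natrX.
    by move=> i _; rewrite (eqP (forallP xS i)) addbb.
  rewrite inE negb_forall => /existsP[i ti]; rewrite mul0r (bigD1 i) //=.
  by move: ti; case: (tr _) (b i) => -[] //=; rewrite mul0r.
transitivity ((\sum_x \prod_i ((-1) ^+ (tr (v i * x) (+) b i) + 1))%R : int).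
  under [RHS]eq_bigr do rewrite ind_S.
  by rewrite -mulr_suml -natr_sum -big_mkcond sum1_card /= !natz.
under eq_bigr do rewrite bigA_distr.
have term (J : {set 'I_n}) (x : F) :
    (\prod_i (if i \in J then (-1) ^+ (tr (v i * x) (+) b i) else 1))%R =
    (\prod_(i in J) (-1) ^+ b i * (-1) ^+ tr ((\sum_(i in J) v i) * x))%R :> int.
  rewrite -big_mkcond mulr_suml tr_sum.
  rewrite (big_morph (fun c : bool => (-1) ^+ c)%R (@signr_addb int) erefl).
  by rewrite -big_split; apply: eq_bigr => i _; rewrite addbC signr_addb.
rewrite exchange_big /= (bigD1 set0) //= [X in _ + X]big1 ?addr0 => [|J J0].
  under eq_bigr do rewrite term big_set0 big_set0 mul0r tr0 mulr1.
  by rewrite sumr_const natz.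
under eq_bigr do rewrite term.
rewrite -mulr_sumr sum_sign_tr; case: eqP => [/(F2_independent_set ind) e|].
  by rewrite e eqxx in J0.
by rewrite mulr0.
Qed.

End TraceTheory.

(** * The system over F_2 *)

Section FiniteCheck.

(* A symmetric 4 x 4 matrix over F_2 has diagonal (d1, d2, d3, r4), last row
   (r1, r2, r3, r4) and remaining entries o12, o13, o23; (x, y, z, w) is lambda. *)
Definition is_sol (d1 d2 d3 o12 o13 o23 r1 r2 r3 r4 k1 k2 k3 k4 x y z w : bool) :=
  [&& k1 (+) (d1 && x) (+) (o12 && y) (+) (o13 && z) (+) (r1 && w)
        (+) (x (+) y (+) z (+) (y && z)) == false,
      k2 (+) (o12 && x) (+) (d2 && y) (+) (o23 && z) (+) (r2 && w)
        (+) (y (+) z (+) (x && z)) == false,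
      k3 (+) (o13 && x) (+) (o23 && y) (+) (d3 && z) (+) (r3 && w)
        (+) (z (+) (x && y)) == false
    & k4 (+) (r1 && x) (+) (r2 && y) (+) (r3 && z) (+) (r4 && w) == false].

(** Written as explicit two-case expressions, for evaluation by [vm_compute]. *)
Let sumb (f : bool -> nat) : nat := (f true + f false)%N.
Let allb (p : bool -> bool) : bool := p true && p false.

Let allbP p : allb p -> forall b, p b.
Proof. by case/andP=> pt pf []. Qed.

Definition nb_sol d1 d2 d3 o12 o13 o23 r1 r2 r3 r4 k1 k2 k3 k4 : nat :=
  sumb (fun x => sumb (fun y => sumb (fun z => sumb (fun w =>
    is_sol d1 d2 d3 o12 o13 o23 r1 r2 r3 r4 k1 k2 k3 k4 x y z w)))).

(* The condition on (Tr(alpha_i alpha_j m)) for (0, 1, m) to lie in S_0. *)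
Definition is_at_infinity d1 d2 d3 r1 r2 r3 r4 : bool :=
  [&& d1 == r1, d2 == r2, d3 == r3 & [|| r1, r2, r3 | r4]].

(** Exhaustive evaluation over 14 bits: the 10 entries of a symmetric matrix and the 4 constants
    Tr(alpha_i k). Here [n] will be the number of arc points on a line missing [(0, 0, 1)]. *)
Let nb_sol_check :
  allb (fun d1 => allb (fun d2 => allb (fun d3 =>
  allb (fun r1 => allb (fun r2 => allb (fun r3 => allb (fun r4 =>
  ([|| d1, d2, d3 | r4] == [|| r1, r2, r3 | r4]) ==>
  allb (fun o12 => allb (fun o13 => allb (fun o23 =>
  allb (fun k1 => allb (fun k2 => allb (fun k3 => allb (fun k4 =>
    let n := (nb_sol d1 d2 d3 o12 o13 o23 r1 r2 r3 r4 k1 k2 k3 k4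
              + is_at_infinity d1 d2 d3 r1 r2 r3 r4)%N in
    match n with 0 | 2 => true | _ => false end)))))))))))))).
Proof. by vm_compute. Qed.

Lemma nb_sol_mem d1 d2 d3 o12 o13 o23 r1 r2 r3 r4 k1 k2 k3 k4 :
  [|| d1, d2, d3 | r4] = [|| r1, r2, r3 | r4] ->
  (nb_sol d1 d2 d3 o12 o13 o23 r1 r2 r3 r4 k1 k2 k3 k4
     + is_at_infinity d1 d2 d3 r1 r2 r3 r4)%N \in [:: 0; 2]%N.
Proof.
move=> /eqP dr; have /allbP/(_ d1)/allbP/(_ d2)/allbP/(_ d3) := nb_sol_check.
move=> /allbP/(_ r1)/allbP/(_ r2)/allbP/(_ r3)/allbP/(_ r4)/implyP/(_ dr).
move=> /allbP/(_ o12)/allbP/(_ o13)/allbP/(_ o23).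
move=> /allbP/(_ k1)/allbP/(_ k2)/allbP/(_ k3)/allbP/(_ k4).
by case: (_ + _)%N => [|[|[|]]].
Qed.

(** Transfers the count from Boolean quadruples to vectors lambda, through the bijection that
    records which coordinates are nonzero. *)
Lemma card_rowF2_4 (C : bool -> bool -> bool -> bool -> bool) :
  #|[set l : 'rV['F_2]_4 | C (l 0 0 != 0) (l 0 1 != 0) (l 0 2 != 0) (l 0 3 != 0)]|
  = sumb (fun x => sumb (fun y => sumb (fun z => sumb (fun w => C x y z w)))).
Proof.
pose D (p : bool * bool * bool * bool) := C p.1.1.1 p.1.1.2 p.1.2 p.2.
pose phi (l : 'rV['F_2]_4) := (l 0 0 != 0, l 0 1 != 0, l 0 2 != 0, l 0 3 != 0).
pose psi (p : bool * bool * bool * bool) : 'rV['F_2]_4 :=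
  \row_j [:: p.1.1.1%:R; p.1.1.2%:R; p.1.2%:R; p.2%:R]`_j.
have phi_bij : bijective phi.
  exists psi => [l|[[[x y] z] w]]; last first.
    by rewrite /phi !mxE /=; case: x y z w => -[] [] [].
  have F2b (c : 'F_2) : (c != 0)%:R = c by apply/val_inj; case: c => -[|[|]].
  apply/rowP=> j; rewrite mxE /= !F2b.
  by case: j => -[|[|[|[|j]]]] i; [..|by []]; congr (l _ _); apply/val_inj.
rewrite -[LHS](_ : #|phi @^-1: [set p | D p]| = _); last first.
  by apply: eq_card => l; rewrite !inE.
rewrite on_card_preimset; last exact: onW_bij.
transitivity (\sum_p (D p : nat))%N.
  by rewrite -sum1_card big_mkcond; apply: eq_bigr => p _; rewrite inE; case: (D p).
transitivity (\sum_x \sum_y \sum_z \sum_w (C x y z w : nat))%N.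
  by rewrite !pair_bigA.
by rewrite !big_bool.
Qed.

End FiniteCheck.

Lemma big_ord4 (R : Type) (idx : R) (op : Monoid.law idx) (f : 'I_4 -> R) :
  \big[op/idx]_i f i = op (op (op (f 0) (f 1)) (f 2%R)) (f 3%R).
Proof.
rewrite !big_ord_recr big_ord0 /= Monoid.mul1m.
by congr (op (op (op (f _) (f _)) (f _)) (f _)); apply/val_inj.
Qed.

Lemma sum_ord3 (V : nmodType) (f : 'I_3 -> V) : \sum_i f i = f 0 + f 1 + f 2%R.
Proof.
rewrite !big_ord_recr big_ord0 /= add0r.
by congr (f _ + f _ + f _); apply/val_inj.
Qed.

Lemma forall_ord4 (P : pred 'I_4) : [forall i, P i] = [&& P 0, P 1, P 2 & P 3].
Proof.
transitivity (\big[andb/true]_i P i); last by rewrite big_ord4 /= !andbA.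
by rewrite big_andE.
Qed.

(** * The arc *)

Section ArcTheory.
Variables (F : finFieldType) (h : nat).
Variables (alpha : 'I_4 -> F) (a : F) (beta : 'I_3 -> F).
Hypotheses (h_gt5 : (5 < h)%N) (cardF : #|F| = (2 ^ h)%N).
Hypotheses (alpha_neq0 : forall i, alpha i != 0).
Hypotheses (alpha_indep : F2_independent alpha).
Hypotheses (alpha_sqr : forall i : 'I_4, (i < 3)%N ->
  alpha i ^+ 2 / alpha 3 \in F2_span alpha).
Hypotheses (a_span : a \in F2_span alpha).
Hypotheses (gamma_indep : F2_independent (gamma alpha a)).
Hypotheses (alpha_beta : forall (i : 'I_4) (j : 'I_3),
  abs_trace h (alpha i * beta j) = (i == j :> nat)%:R).
Implicit Types (k m x y z s : F) (l : 'rV['F_2]_4).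

Let h_gt0 : (0 < h)%N. Proof. by case: h h_gt5. Qed.

Local Notation Tr := (tr h).
Local Notation S := (S_set h alpha).
Local Notation arc := (arc_points h alpha a beta).
Local Notation q16 := (#|F| %/ 16)%N.

(** The points of S_lambda are [(1, A l, B l + s)] with [s] in [S]; those of S_0 are [(0, 1, x)]
    with [x] in [T0]. *)
Let A l : F := \sum_i alpha i *+ l 0 i.
Let B l : F := \sum_i beta i *+ f_poly i (l 0 0) (l 0 1) (l 0 2).
Let T0 : {set F} := [set x | [forall i, Tr (gamma alpha a i * x) == (i == 3 :> nat)]].

Lemma mem_S s : (s \in S) = [forall i, Tr (alpha i * s) == false].
Proof.
by rewrite inE; apply: eq_forallb => i; rewrite eqbF_neg negbK.
Qed.

Lemma S_add s s' : s \in S -> s' \in S -> s + s' \in S.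
Proof.
rewrite !mem_S => /forallP ss /forallP ss'; apply/forallP=> i.
by rewrite mulrDr (trD h_gt0 cardF) (eqP (ss i)) (eqP (ss' i)).
Qed.

Let card_fiber4 (v : 'I_4 -> F) b : F2_independent v ->
  #|[set x | [forall i, Tr (v i * x) == b i]]| = q16.
Proof. by move=> ind; rewrite -(card_tr_fiber h_gt0 cardF b ind) mulnK. Qed.

Lemma card_S : #|S| = q16.
Proof.
rewrite -(card_fiber4 (fun _ => false) alpha_indep).
by apply: eq_card => s; rewrite mem_S inE.
Qed.

Lemma card_T0 : #|T0| = q16.
Proof. exact: card_fiber4. Qed.

Lemma q16_gt2 : (2 < q16)%N.
Proof.
(* As h is at least 6, q is a multiple of 64 and q/16 is at least 4. *)
rewrite cardF -(subnKC h_gt5) expnD -[(2 ^ 6)%N]/(4 * 16)%N mulnAC mulnK //.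
by rewrite (leq_trans (isT : 2 < 4)%N) // leq_pmulr // expn_gt0.
Qed.

Lemma S_zeroE : S_zero h alpha a = [set pt 0 1 x | x in T0].
Proof.
have T0E x : [forall i : 'I_4, (i < 3)%N ==>
      (abs_trace h (alpha i * (alpha i + alpha 3) * x) == 0)] &&
    (abs_trace h (alpha 3 * a * x) == 1) = (x \in T0).
  rewrite inE !forall_ord4 /gamma /= !(abs_traceE h_gt0 cardF) /= !eqbF_neg eqb_id.
  by rewrite !andbA; do 4!case: (Tr _);
    rewrite /= ?eqxx ?oner_eq0 ?[0 == 1]eq_sym ?oner_eq0.
apply/setP=> P; rewrite inE; apply/existsP/imsetP => [[x]|[x xT ->]].
  by rewrite has_coordsE ?coords01_neq0 // T0E => /andP[/eqP-> ?]; exists x.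
by exists x; rewrite has_coordsE ?coords01_neq0 // eqxx T0E.
Qed.

Lemma mem_S_lambda l P :
  (P \in S_lambda h alpha beta l) = [exists s in S, P == pt 1 (A l) (B l + s)].
Proof.
by rewrite inE; apply: eq_existsb => s; rewrite has_coordsE ?coords1_neq0.
Qed.

Lemma arcP P : reflect
  ((exists2 x, x \in T0 & P = pt 0 1 x) \/
   (exists l s, s \in S /\ P = pt 1 (A l) (B l + s)))
  (P \in arc).
Proof.
rewrite /arc_points S_zeroE; apply: (iffP setUP) => -[].
- by case/imsetP=> x xT ->; left; exists x.
- case/bigcupP=> l _; rewrite mem_S_lambda => /exists_inP[s sS /eqP->].
  by right; exists l, s.
- by case=> x xT ->; left; apply/imsetP; exists x.
- case=> l [s [sS ->]]; right; apply/bigcupP; exists l => //.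
  by rewrite mem_S_lambda; apply/exists_inP; exists s.
Qed.

Lemma pt01_arc x : (pt 0 1 x \in arc) = (x \in T0).
Proof.
apply/arcP/idP => [[[x' xT /pt01_inj->//]|[l [s [_ /eqP]]]]|xT].
  by rewrite (negPf (pt01_neq_pt1 _ _ _)).
by left; exists x.
Qed.

Lemma pt1_arcP y z :
  reflect (exists2 l, y = A l & z + B l \in S) (pt 1 y z \in arc).
Proof.
apply: (iffP (arcP _)) => [[[x _ /esym/eqP]|[l [s [sS /pt1_inj[-> ->]]]]]|[l -> zS]].
- by rewrite (negPf (pt01_neq_pt1 _ _ _)).
- by exists l; rewrite // addrC addrA (addrr2 cardF) add0r.
- right; exists l, (z + B l); split=> //.
  by rewrite addrCA (addrr2 cardF) addr0.
Qed.

Let mulr_F2 x (c : 'F_2) : x *+ c = if c != 0 then x else 0.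
Proof. by case: c => -[|[|]]. Qed.

Let F2_addb (c d : 'F_2) : (c + d != 0) = (c != 0) (+) (d != 0).
Proof. by case: c d => -[|[|//]] i [[|[|//]] j]. Qed.

Let F2_subb (c d : 'F_2) : (c - d != 0) = (c != 0) (+) (d != 0).
Proof. by case: c d => -[|[|//]] i [[|[|//]] j]. Qed.

Let F2_mulb (c d : 'F_2) : (c * d != 0) = (c != 0) && (d != 0).
Proof. by rewrite mulf_eq0 negb_or. Qed.

(** By independence of the [alpha i]. It makes each line [Y = yX] meet at most one S_lambda. *)
Lemma A_inj : injective A.
Proof.
move=> l l' e; apply/rowP=> i; apply/eqP; rewrite -subr_eq0; apply/eqP.
apply: (alpha_indep (c := fun i => l 0 i - l' 0 i)).
rewrite -[RHS](addrr2 cardF (A l)) {2}e -big_split; apply: eq_bigr => j _.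
rewrite !mulr_F2 F2_subb.
by do 2!case: (_ != 0); rewrite /= ?addr0 ?add0r // (addrr2 cardF).
Qed.

Lemma A0 : A 0 = 0.
Proof. by rewrite /A big1 // => i _; rewrite mxE mulr0n. Qed.

Lemma B0 : B 0 = 0.
Proof.
rewrite /B big1 // => -[[|[|[|//]]] i] _; rewrite /f_poly !mxE /=;
  by rewrite ?mul0r ?addr0 mulr0n.
Qed.

Let o i j m := Tr (alpha i * alpha j * m).

(** [S] is cut out by the four functionals Tr(alpha_i x). On [m * A l] they give the rows of M, with
    entries [o i j m]; on [B l] they give f_1, f_2, f_3, 0, since the [beta j] are dual to the first
    three [alpha i]. *)
Lemma sol_trace k m l : (k + m * A l + B l \in S) =
  is_sol (o 0 0 m) (o 1 1 m) (o 2 2 m) (o 0 1 m) (o 0 2 m) (o 1 2 m)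
    (o 0 3 m) (o 1 3 m) (o 2 3 m) (o 3 3 m)
    (Tr (alpha 0 * k)) (Tr (alpha 1 * k)) (Tr (alpha 2 * k)) (Tr (alpha 3 * k))
    (l 0 0 != 0) (l 0 1 != 0) (l 0 2 != 0) (l 0 3 != 0).
Proof.
have TrF2 x y (c : 'F_2) : Tr (x * (y *+ c)) = Tr (x * y) && (c != 0).
  by rewrite mulr_F2; case: (c != 0); rewrite ?andbT ?andbF // mulr0 (tr0 cardF).
have TrA i : Tr (alpha i * (m * A l)) = o i 0 m && (l 0 0 != 0) (+)
    o i 1 m && (l 0 1 != 0) (+) o i 2 m && (l 0 2 != 0) (+) o i 3 m && (l 0 3 != 0).
  rewrite /A big_ord4 /= !mulrDr !(trD h_gt0 cardF) !mulrA !TrF2.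
  by rewrite /o !(mulrAC _ m).
have TrB i : Tr (alpha i * B l) =
    (i == 0 :> nat) && (f_poly 0 (l 0 0) (l 0 1) (l 0 2) != 0) (+)
    (i == 1 :> nat) && (f_poly 1 (l 0 0) (l 0 1) (l 0 2) != 0) (+)
    (i == 2 :> nat) && (f_poly 2 (l 0 0) (l 0 1) (l 0 2) != 0).
  have Trab j : Tr (alpha i * beta j) = (i == j :> nat).
    by rewrite /tr alpha_beta; case: (i == j :> nat); rewrite ?eqxx ?oner_eq0.
  by rewrite /B sum_ord3 !mulrDr !(trD h_gt0 cardF) !TrF2 !Trab.
have oC i j : o i j m = o j i m by rewrite /o [alpha i * _]mulrC.
rewrite mem_S forall_ord4 !mulrDr !(trD h_gt0 cardF) !TrA !TrB /f_poly /=.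
rewrite !F2_addb !F2_mulb !addbF /is_sol !addbA.
by rewrite (oC 1 0) (oC 2 0) (oC 2 1) (oC 3 0) (oC 3 1) (oC 3 2).
Qed.

(** * The diagonal and the last row of M *)

Let delta i := alpha 3 * alpha i.

Let delta3 : delta 3 = alpha 3 ^+ 2.
Proof. by rewrite expr2. Qed.

(** For the first three indices, multiply the hypothesis on [alpha i ^+ 2 / alpha 3] by [alpha 3];
    the last square is [delta 3] itself. *)
Let sq_span i : alpha i ^+ 2 \in span2 delta.
Proof.
have [i_lt3|i_ge3] := ltnP i 3; last first.
  suff -> : i = 3 by rewrite -delta3 span2_gen.
  by apply/val_inj; case: i i_ge3 => -[|[|[|[|]]]].
have /(subsetP (F2_span_sub cardF _)) := alpha_sqr i_lt3.
by move=> /(span2_mull (alpha 3)); rewrite mulrCA divff ?mulr1.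
Qed.

(** The first three elements are [alpha i ^+ 2 + delta i]; the last is [alpha 3] times the element
    [a] of the span of [alpha]. *)
Let gamma_span i : gamma alpha a i \in span2 delta.
Proof.
rewrite /gamma; case: ifP => _; last first.
  exact/span2_mull/(subsetP (F2_span_sub cardF _)).
rewrite mulrDr -expr2 [_ * alpha 3]mulrC; apply: (span2D cardF); first exact: sq_span.
exact: (span2_gen delta).
Qed.

(** Squaring is additive and injective, so a vanishing sum of squares comes from a vanishing sum of
    the [alpha i]. *)
Let sq_indep : F2_independent (fun i => alpha i ^+ 2).
Proof.
apply: F2_independentP => J /eqP; rewrite -(sqr_sum2 cardF) sqrf_eq0 => /eqP.
exact: F2_independent_set.
Qed.

(* By additivity of the trace, the last row of (Tr(alpha_i alpha_j m)) vanishes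
   on delta = alpha_4 alpha iff it vanishes on any other basis of its span. *)
Let row_vanish (v : 'I_4 -> F) m : F2_independent v ->
  (forall i, v i \in span2 delta) ->
  [forall i, ~~ Tr (delta i * m)] = [forall i, ~~ Tr (v i * m)].
Proof.
move=> ind vd; apply/forallP/forallP => dm i.
  exact: (tr_span2 h_gt0 cardF dm).
exact/(tr_span2 h_gt0 cardF dm)/(span2_exchange cardF).
Qed.

Let row_delta m : [forall i, ~~ Tr (delta i * m)] =
  ~~ [|| o 0 3 m, o 1 3 m, o 2 3 m | o 3 3 m].
Proof. by rewrite forall_ord4 /o /delta !negb_or !(mulrC (alpha 3)). Qed.

(** The diagonal entries are the traces of [alpha i ^+ 2 * m], so [row_vanish] applies to the basis
    of squares. *)
Lemma diag_row m : [|| o 0 0 m, o 1 1 m, o 2 2 m | o 3 3 m] =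
  [|| o 0 3 m, o 1 3 m, o 2 3 m | o 3 3 m].
Proof.
apply: negb_inj; rewrite -row_delta (row_vanish _ sq_indep) //.
by rewrite forall_ord4 /o !negb_or !expr2.
Qed.

(** The first three traces are [o i i m (+) o i 3 m], and vanish iff the diagonal agrees with the
    last row. Once they vanish, the fourth is nonzero iff not all traces against [gamma] vanish,
    which by [row_vanish] means that the last row is nonzero. *)
Lemma T0_at_infinity m : (m \in T0) =
  is_at_infinity (o 0 0 m) (o 1 1 m) (o 2 2 m) (o 0 3 m) (o 1 3 m) (o 2 3 m) (o 3 3 m).
Proof.
have := row_vanish m gamma_indep gamma_span; rewrite row_delta.
have g (i : 'I_4) : (i < 3)%N -> Tr (gamma alpha a i * m) = o i i m (+) o i 3 m.
  by move=> i3; rewrite /gamma i3 mulrDr mulrDl (trD h_gt0 cardF).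
rewrite inE !forall_ord4 (g 0) // (g 1) // (g 2) // /is_at_infinity /=.
by do 7!case: (o _ _ m); case: (Tr _).
Qed.

(** * Intersections of the arc with lines *)

Lemma card_arc_line k m : #|arc :&: line k m 1| \in [:: 0; 2]%N.
Proof.
pose sol := [set l | k + m * A l + B l \in S].
(* Each solution [l] gives one point with [X = 1], and the only point of the line on [X = 0] is
   [(0, 1, m)]. *)
have -> : arc :&: line k m 1 = [set pt 1 (A l) (k + m * A l) | l in sol] :|:
    (if m \in T0 then [set pt 0 1 m] else set0).
  apply/setP=> P; rewrite in_setI [RHS]in_setU; apply/andP/orP => [[/arcP]|].
  - case=> [[x xT ->]|[l [s [sS ->]]]];
      rewrite mem_line ?coords01_neq0 ?coords1_neq0 //.
      rewrite mulr0 add0r mulr1 mul1r (addr2_eq0 cardF) => /eqP->.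
      by right; rewrite xT set11.
    rewrite mul1r mulr1 (addr2_eq0 cardF) => /eqP e.
    left; apply/imsetP; exists l; last by rewrite e.
    by rewrite inE e addrAC (addrr2 cardF) add0r.
  - case=> [/imsetP[l]|].
      rewrite inE => lS ->; split; first by apply/pt1_arcP; exists l.
      by rewrite mem_line ?coords1_neq0 // mulr1 mul1r (addrr2 cardF).
    case: ifP => mT; rewrite inE // => /eqP->; rewrite pt01_arc; split=> //.
    by rewrite mem_line ?coords01_neq0 // mulr0 add0r mulr1 mul1r (addrr2 cardF).
rewrite cardsU card_imset => [|l l' /pt1_inj[/A_inj]//].
have -> : #|sol| = nb_sol (o 0 0 m) (o 1 1 m) (o 2 2 m) (o 0 1 m) (o 0 2 m) (o 1 2 m)
    (o 0 3 m) (o 1 3 m) (o 2 3 m) (o 3 3 m)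
    (Tr (alpha 0 * k)) (Tr (alpha 1 * k)) (Tr (alpha 2 * k)) (Tr (alpha 3 * k)).
  rewrite /nb_sol -card_rowF2_4; apply: eq_card => l.
  by rewrite [RHS]inE -sol_trace [LHS]inE.
rewrite (_ : _ :&: _ = set0) ?cards0 ?subn0; last first.
  apply/setP=> P; rewrite in_set0 in_setI; apply/negbTE/negP=> /andP[/imsetP[l _ ->]].
  by case: ifP => _; rewrite inE // eq_sym (negPf (pt01_neq_pt1 _ _ _)).
rewrite [X in (_ + X)%N](_ : _ = (m \in T0) :> nat).
  rewrite T0_at_infinity; apply: nb_sol_mem; exact: diag_row.
by case: (m \in T0); rewrite ?cards1 ?cards0.
Qed.

(** Provides a 2-secant: [(1, 0, 0)] lies in S_lambda for lambda = 0, which rules out an empty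
    intersection. *)
Lemma card_arc_line001 : #|arc :&: line 0 0 1| = 2.
Proof.
have := card_arc_line 0 0; rewrite !inE => /orP[|/eqP//].
rewrite cards_eq0 => /eqP/setP/(_ (pt 1 0 0)); rewrite in_set0 inE => /negP[].
rewrite mem_line ?coords1_neq0 // !mul0r mulr0 !addr0 eqxx andbT.
apply/pt1_arcP; exists 0; rewrite ?A0 // B0 addr0 mem_S.
by apply/forallP=> i; rewrite mulr0 (tr0 cardF).
Qed.

Lemma card_arc_axis : #|arc :&: line 1 0 0| = q16.
Proof.
rewrite -card_T0 -(card_imset _ (@pt01_inj F)); apply: eq_card => P.
rewrite inE; apply/andP/imsetP => [[/arcP[[x xT ->]|[l [s [_ ->]]]]]|[x xT ->]].
- by exists x.
- by rewrite mem_line ?coords1_neq0 // mulr1 !mul0r !addr0 oner_eq0.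
- by rewrite pt01_arc mem_line ?coords01_neq0 // mulr0 !mul0r !addr0 eqxx.
Qed.

Lemma mem_arc_vertical y P :
  P \in arc :&: line y 1 0 -> exists z, P = pt 1 y z.
Proof.
case/setIP=> /arcP[[x _ ->]|[l [s [_ ->]]]].
  by rewrite mem_line ?coords01_neq0 // mulr0 mul0r mul1r addr0 add0r oner_eq0.
rewrite mem_line ?coords1_neq0 // mulr1 mul0r mul1r addr0.
by rewrite (addr2_eq0 cardF) => /eqP->; exists (B l + s).
Qed.

Lemma pt1_vertical y z : pt 1 y z \in line y 1 0.
Proof.
by rewrite mem_line ?coords1_neq0 // mulr1 mul0r mul1r addr0 (addrr2 cardF).
Qed.

Lemma card_arc_vertical l : #|arc :&: line (A l) 1 0| = q16.
Proof.
rewrite -card_S -(card_imset _ (f := fun s => pt 1 (A l) (B l + s))); last first.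
  by move=> s s' /pt1_inj[_ /addrI].
apply: eq_card => P; apply/idP/imsetP => [Pl|[s sS ->]].
  have [z eP] := mem_arc_vertical Pl; move: Pl; rewrite {}eP.
  case/setIP=> /pt1_arcP[l' /A_inj<- zS] _; exists (z + B l) => //.
  by rewrite addrCA (addrr2 cardF) addr0.
rewrite inE pt1_vertical andbT; apply/pt1_arcP; exists l => //.
by rewrite addrAC (addrr2 cardF) add0r.
Qed.

Lemma card_arc_vertical0 y : (forall l, y != A l) -> #|arc :&: line y 1 0| = 0%N.
Proof.
move=> yA; apply/eqP; rewrite cards_eq0; apply/eqP/setP=> P; rewrite in_set0.
apply/negbTE/negP=> Pl; have [z eP] := mem_arc_vertical Pl; move: Pl; rewrite {}eP.
by case/setIP=> /pt1_arcP[l /eqP]; rewrite (negPf (yA l)).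
Qed.

(** Normal forms of a line: the axis, the other lines through [(0, 0, 1)], and the lines missing
    that point. *)
Variant line_spec : {set point F} -> Prop :=
  | LineAxis : line_spec (line 1 0 0)
  | LineVertical y : line_spec (line y 1 0)
  | LineOblique k m : line_spec (line k m 1).

Lemma line_specP (L : {set point F}) : L \in lines F -> line_spec L.
Proof.
case/linesP=> u [v [w [n0 ->]]].
have [w0|w0] := eqVneq w 0; last first.
  by rewrite -(eq_line_scale u v w (invr_neq0 w0)) mulVf //; exact: LineOblique.
have [v0|v0] := eqVneq v 0; last first.
  rewrite -(eq_line_scale u v w (invr_neq0 v0)) mulVf // w0 mulr0.
  exact: LineVertical.
have u0 : u != 0 by apply: contraNneq n0 => ->; rewrite v0 w0.
rewrite -(eq_line_scale u v w (invr_neq0 u0)) mulVf // w0 v0 mulr0.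
exact: LineAxis.
Qed.

(** Points of S_0 are fixed, and on S_lambda [c] is added to [s], under which [S] is closed;
    equality then follows by cardinality. *)
Lemma shear_arc c : c \in S -> shear c @: arc = arc.
Proof.
move=> cS; apply/eqP; rewrite eqEcard card_imset ?leqnn ?andbT; last exact: perm_inj.
apply/subsetP=> _ /imsetP[P /arcP[[x xT]|[l [s [sS]]]] -> ->].
  by rewrite shear_pt ?coords01_neq0 // mulr0 add0r pt01_arc.
rewrite shear_pt ?coords1_neq0 // mulr1 addrCA; apply/arcP; right.
by exists l, (c + s); split=> //; exact: S_add.
Qed.

Lemma card_arc : #|arc| = (#|F| + q16)%N.
Proof.
pose f (u : 'rV['F_2]_4 * F) := pt 1 (A u.1) (B u.1 + u.2).
have f_inj : injective f.
  by move=> [l s] [l' s'] /pt1_inj[/= /A_inj<- /addrI->].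
have -> : arc = f @: setX setT S :|: [set pt 0 1 x | x in T0].
  apply/setP=> P; rewrite [RHS]in_setU orbC; apply/arcP/orP => -[].
  - by case=> x xT ->; left; apply/imsetP; exists x.
  - case=> l [s [sS ->]]; right; apply/imsetP; exists (l, s) => //.
    by rewrite inE in_setT.
  - by case/imsetP=> x xT ->; left; exists x.
  - by case/imsetP=> -[l s]; rewrite inE => /andP[_ sS] ->; right; exists l, s.
rewrite cardsU card_imset // cardsX cardsT card_mx card_Fp // card_S.
rewrite card_imset ?card_T0; last exact: pt01_inj.
rewrite (_ : _ :&: _ = set0) ?cards0 ?subn0; last first.
  apply/setP=> P; rewrite in_set0 in_setI; apply/negbTE/negP.
  case/andP=> /imsetP[u _ ->] /imsetP[x _ /eqP].
  by rewrite eq_sym (negPf (pt01_neq_pt1 _ _ _)).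
(* Since [4 <= h], 16 divides q, so the 16 sets S_lambda have q points together. *)
congr (_ + _)%N; rewrite cardF -(subnKC (ltnW (ltnW h_gt5))) expnD mulnC.
by rewrite -[(2 ^ (1 * 4))%N]/(2 ^ 4)%N -[16%N]/(2 ^ 4)%N mulKn // mulnC.
Qed.

(** [A] takes only 16 values, fewer than q. The line [Y = yX] for such a [y] is a 0-secant. *)
Lemma exists_not_A : exists y, forall l, y != A l.
Proof.
have /subsetPn[y _ yA] : ~~ ([set: F] \subset A @: setT).
  apply/negP=> /subset_leq_card; rewrite card_imset; last exact: A_inj.
  rewrite !cardsT card_mx card_Fp // cardF leq_exp2l //.
  by apply/negP; rewrite -ltnNge mul1n ltnW.
by exists y => l; apply: contraNneq yA => ->; exact: imset_f.
Qed.

Lemma card_arc_vertical_mem y : #|arc :&: line y 1 0| \in [:: 0; q16]%N.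
Proof.
have [/existsP[l /eqP->]|] := boolP [exists l, y == A l].
  by rewrite card_arc_vertical !inE eqxx orbT.
by rewrite negb_exists => /forallP/card_arc_vertical0->.
Qed.

Lemma arc_KM : KM_arc q16 arc.
Proof.
split; first exact: card_arc.
- move=> L /line_specP[|y|k m].
  + by rewrite card_arc_axis !inE eqxx !orbT.
  + by have := card_arc_vertical_mem y; rewrite !inE => /orP[]->; rewrite ?orbT.
  + by have := card_arc_line k m; rewrite !inE orbA => ->.
- have [y yA] := exists_not_A.
  move=> i; rewrite !inE => /or3P[] /eqP->; apply/set0Pn.
  + exists (line y 1 0); rewrite inE card_arc_vertical0 // eqxx andbT.
    by rewrite mem_lines // !xpair_eqE oner_eq0 andbF.
  + by exists (line 0 0 1); rewrite inE card_arc_line001 eqxx mem_lines ?coords001_neq0.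
  + by exists (line 1 0 0); rewrite inE card_arc_axis eqxx mem_lines ?coords1_neq0.
Qed.

(** Lines missing [(0, 0, 1)] meet the arc in 0 or 2 points, and q/16 exceeds 2. *)
Lemma secant_q16 (L : {set point F}) : L \in secants arc q16 ->
  L = line 1 0 0 \/ exists l, L = line (A l) 1 0.
Proof.
rewrite inE => /andP[/line_specP[|y|k m]]; first by left.
- have [/existsP[l /eqP->] _|] := boolP [exists l, y == A l]; first by right; exists l.
  rewrite negb_exists => /forallP/card_arc_vertical0->.
  by rewrite eq_sym gtn_eqF // (ltn_trans _ q16_gt2).
- have := card_arc_line k m; rewrite !inE => /orP[]/eqP->.
    by rewrite eq_sym gtn_eqF // (ltn_trans _ q16_gt2).
  by rewrite eq_sym gtn_eqF // q16_gt2.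
Qed.

Lemma arc_nucleus : nucleus q16 arc (pt 0 0 1).
Proof.
rewrite /nucleus; apply/setP=> P; rewrite inE; apply/bigcapP/eqP => [PL|-> L].
  (* Two secants determine the point: the axis, and the line [Y = 0] that carries S_lambda for
     lambda = 0. *)
  apply: pt_in_X0_Y0; apply: PL; rewrite inE.
    by rewrite card_arc_axis eqxx mem_lines ?coords1_neq0.
  by have := card_arc_vertical 0; rewrite A0 => ->; rewrite eqxx mem_lines ?coords01_neq0.
by case/secant_q16=> [|[l]] ->; rewrite mem_line ?coords001_neq0 // !mulr0 mul0r !addr0.
Qed.

Lemma arc_elation : elation_KM_arc q16 arc (line 1 0 0).
Proof.
split; [exact: arc_KM | exact: q16_gt2 | by rewrite mem_lines ?coords1_neq0 |].
move=> L /secant_q16[->|[l ->] _ P Q Pl Ql]; first by rewrite eqxx.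
have [z eP] := mem_arc_vertical Pl; have [z' eQ] := mem_arc_vertical Ql.
subst P Q; case/setIP: Pl => /pt1_arcP[l1 /A_inj<- zS] _.
case/setIP: Ql => /pt1_arcP[l2 /A_inj<- z'S] _.
(* Both [z] and [z'] lie in the coset of [S] by [B l], so their difference, which is their sum, lies
   in [S] and defines the elation. *)
have cS : z + z' \in S.
  have := S_add zS z'S.
  by rewrite addrACA (addrr2 cardF) addr0.
exists (shear (z + z')); last first.
  by rewrite shear_pt ?coords1_neq0 // mulr1 addrC addrA (addrr2 cardF) add0r.
rewrite inE shear_arc // eqxx andbT; apply/existsP; exists (pt 0 0 1).
exact: shear_elation.
Qed.

End ArcTheory.

Theorem theorem5p2 (F : finFieldType) (h : nat)
    (alpha : 'I_4 -> F) (a : F) (beta : 'I_3 -> F)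
    (h_gt5 : (5 < h)%N) (cardF : #|F| = (2 ^ h)%N)
    (alpha_neq0 : forall i, alpha i != 0)
    (alpha_indep : F2_independent alpha)
    (alpha_sqr : forall i : 'I_4, (i < 3)%N ->
       alpha i ^+ 2 / alpha 3 \in F2_span alpha)
    (a_span : a \in F2_span alpha)
    (gamma_indep : F2_independent (gamma alpha a))
    (beta_neq0 : forall j, beta j != 0)
    (alpha_beta : forall (i : 'I_4) (j : 'I_3),
       abs_trace h (alpha i * beta j) = (i == j :> nat)%:R) :
  elation_KM_arc (#|F| %/ 16) (arc_points h alpha a beta) (line 1 0 0) /\
  exists2 N : point F,
    has_coords N 0 0 1 & nucleus (#|F| %/ 16) (arc_points h alpha a beta) N.
Proof.
split; first exact: arc_elation.
exists (pt 0 0 1); last exact: arc_nucleus.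
by rewrite has_coordsE ?coords001_neq0.
Qed.
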